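(* Let $\mathcal G$ be a finite nonempty collection of allowed words of $\Sigma_A$ and let $r$ be the maximal length of a word in $\mathcal G$. Then the limit defining the escape rate $\rho(H_{\mathcal G})$ exists and $$\rho(H_{\mathcal G})=-\ln\lambda(B_{\mathcal G}\circ P_{r-1}),$$ where $\lambda(\cdot)$ denotes spectral radius and $\circ$ the Hadamard (entrywise) product (with the convention $P_0:=P$ when $r=1$). Moreover $\rho(H_{\mathcal G})>0$.
   Context: Let $\Sigma=\{1,\dots,N\}$ and let $A$ be an irreducible $N\times N$ matrix with entries in $\{0,1\}$ (for all $i,j$ there is $n\ge1$ with $(A^n)_{ij}>0$). The subshift of finite type is $\Sigma_A=\{x=(x_n)_{n\ge1}\in\Sigma^{\mathbb N}: A_{x_nx_{n+1}}=1\ \forall n\ge1\}$ with left shift $\sigma$. A finite word is allowed if it appears (as consecutive symbols) in some $x\in\Sigma_A$; $\mathcal L_n$ is the set of allowed words of length $n$. For an allowed word $w$, the cylinder $C_w$ is the set of $x\in\Sigma_A$ beginning with $w$. $P$ is an $N\times N$ row-stochastic matrix compatible with $A$ ($P_{ij}>0$ iff $A_{ij}=1$), $\mathbf p$ its stationary vector ($\mathbf p^TP=\mathbf p^T$, entries summing to 1), and $\mu=\mu_P$ the Markov measure with $\mu(C_w)=p_{w_1}P_{w_1w_2}\cdots P_{w_{n-1}w_n}$ for $w=w_1\cdots w_n$. For a finite collection $\mathcal G$ of allowed words, the Markov hole is $H_{\mathcal G}=\bigcup_{w\in\mathcal G}C_w$. For a hole $H$, $\mathcal W_m=\{x\in\Sigma_A:\sigma^ix\notin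 H \text{ for } 0\le i\le m\}$ and the escape rate is $\rho(H)=-\lim_{m\to\infty}\frac1m\ln\mu(\mathcal W_m)$. Higher block matrices: for $n\ge1$ and $X=x_1\cdots x_n,\ Y=y_1\cdots y_n\in\mathcal L_n$ with $x_2\cdots x_n=y_1\cdots y_{n-1}$ (vacuous if $n=1$) put $X*Y=x_1\cdots x_ny_n$. $P_n$ is the matrix indexed by $\mathcal L_n$ with $(P_n)_{XY}=P_{x_ny_n}$ if $x_2\cdots x_n=y_1\cdots y_{n-1}$ and $X*Y\in\mathcal L_{n+1}$, and $0$ otherwise ($P_1=P$). Adjacency matrix of the open system: if $r\ge2$, $B_{\mathcal G}$ is the $0$–$1$ matrix indexed by $\mathcal L_{r-1}$ with $(B_{\mathcal G})_{XY}=1$ iff $X*Y$ is defined, $X*Y\in\mathcal L_r$, and $X*Y$ contains no word of $\mathcal G$ as a subword; if $r=1$, $B_{\mathcal G}$ is indexed by $\Sigma$ with $(B_{\mathcal G})_{ij}=1$ iff $ij\in\mathcal L_2$ and $i,j\notin\mathcal G$. *)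

(* Defs.v *)
From HB Require Import structures.
From mathcomp Require Import all_boot all_order all_algebra.
From mathcomp Require Import all_classical all_reals all_analysis.
From mathcomp Require Import complex.
Set Implicit Arguments.
Unset Strict Implicit.
Unset Printing Implicit Defensive.
Import Order.TTheory GRing.Theory Num.Theory.
Local Open Scope ring_scope.

Section MarkovHoles.
Variables (R : realType) (N : nat).

Definition word := seq 'I_N.

(* x : nat -> 'I_N is a point of Sigma_A (indices start at 0 instead of 1). *)
Definition in_SFT (A : 'M[R]_N) (x : nat -> 'I_N) : Prop :=
  forall n, A (x n) (x n.+1) = 1.

Definition allowed (A : 'M[R]_N) (w : word) : Prop :=
  exists x, in_SFT A x /\ exists k, w = mkseq (fun i => x (k + i)%N) (size w).

Definition cyl_measure (p : 'rV[R]_N) (P : 'M[R]_N) (w : word) : R :=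
  if w is a :: _ then
    p ord0 a * \prod_(i < (size w).-1) P (nth a w i) (nth a w i.+1)
  else 1.

(* x in W_m  <=>  for 0 <= i <= m, sigma^i x does not begin with a word of G.
   For r = max length in G, this only depends on x_1 ... x_{m+r}. *)
Definition avoids (G : seq word) (m : nat) (w : word) : bool :=
  [forall i : 'I_m.+1, all (fun g => take (size g) (drop i w) != g) G].

Definition maxlen (G : seq word) : nat := \max_(g <- G) size g.

(* mu(W_m): W_m is the disjoint union of the cylinders C_w, w allowed of
   length m + r avoiding G at positions 0..m. *)
Definition mu_W (A : 'M[R]_N) (p : 'rV[R]_N) (P : 'M[R]_N) (G : seq word)
    (m : nat) : R :=
  \sum_(w : (m + maxlen G).-tuple 'I_N | `[< allowed A w >] && avoids G m w)
     cyl_measure p P w.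

Definition Lw (A : 'M[R]_N) (k : nat) :=
  {w : k.+1.-tuple 'I_N | `[< allowed A w >]}.

Definition overlap (X Y : word) : bool := behead X == take (size Y).-1 Y.
Definition star (X Y : word) : word := X ++ drop (size Y).-1 Y.

(* Higher block matrix P_{k+1}, indexed by L_{k+1}. *)
Definition Pblock (A P : 'M[R]_N) (k : nat) (X Y : Lw A k) : R :=
  if overlap (val X) (val Y) && `[< allowed A (star (val X) (val Y)) >]
  then P (tnth (val X) ord_max) (tnth (val Y) ord_max) else 0.

(* Adjacency matrix B_G for r = k + 2 >= 2, indexed by L_{r-1} = L_{k+1}. *)
Definition Bhole (A : 'M[R]_N) (G : seq word) (k : nat) (X Y : Lw A k) : R :=
  if [&& overlap (val X) (val Y), `[< allowed A (star (val X) (val Y)) >] &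
        all (fun g => ~~ infix g (star (val X) (val Y))) G]
  then 1 else 0.

Definition Bhole1 (A : 'M[R]_N) (G : seq word) : 'M[R]_N :=
  \matrix_(i, j) (if [&& `[< allowed A [:: i; j] >], [:: i] \notin G &
                       [:: j] \notin G] then 1 else 0).

End MarkovHoles.

Arguments Pblock {R N} A P k X Y.
Arguments Bhole {R N} A G k X Y.

Definition hadamard (R : pzRingType) (T : finType) (M1 M2 : T -> T -> R) :
  T -> T -> R := fun X Y => M1 X Y * M2 X Y.

(* A T x T matrix (T finite) as an ordinary square matrix, via enumeration of T
   (the spectral radius does not depend on the chosen enumeration). *)
Definition mx_of_fun (R : pzRingType) (T : finType) (M : T -> T -> R) : 'M[R]_#|T| :=
  \matrix_(i, j) M (enum_val i) (enum_val j).

Definition spectral_radius (R : realType) (n : nat) (M : 'M[R]_n) : R :=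
  sup [set (@Normc.normc R z) | z in
        [set z : R[i] | eigenvalue (map_mx (fun x => (x%:C)%C) M) z]].

Definition lambda_hole (R : realType) (N : nat) (A P : 'M[R]_N)
    (G : seq (word N)) : R :=
  match maxlen G with
  | 0 => 0
  | 1 => spectral_radius (\matrix_(i, j)
           hadamard (fun a b : 'I_N => Bhole1 A G a b) (fun a b => P a b) i j)
  | k.+2 => spectral_radius (mx_of_fun (hadamard (Bhole A G k) (Pblock A P k)))
  end.

Definition eln (R : realType) (x : R) : \bar R :=
  if x == 0 then -oo%E else (ln x)%:E.

(* Main.v *)
(**
Let [S n] be the measure of the cylinders of length [n] whose word contains no
word of the hole. Then [S (m + r) <= mu (W_m) <= S m], and
[S (k.+1 + m) = \sum_i mu(i) \sum_j (M ^+ m) i j] up to boundary terms, where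
[M] is the killed transition matrix on blocks of length [k.+1]; so [mu (W_m)]
grows like the entries of [M ^+ m]. An eigenvector for an eigenvalue of maximal
modulus bounds them from below by a multiple of [lambda ^+ m], and
Cayley-Hamilton bounds them from above by [C * t ^+ m] for every [t > lambda],
with [M] nilpotent if [lambda = 0]. Finally [lambda < 1]: by
irreducibility, from every letter some path of positive probability completes a
word of the hole, so [S] contracts by a fixed factor over a fixed number of
steps.
*)
Require Import Defs.
From HB Require Import structures.
From mathcomp Require Import all_boot all_order all_algebra.
From mathcomp Require Import all_classical all_reals all_analysis.
From mathcomp Require Import complex ring lra zify.
Import Order.TTheory GRing.Theory Num.Theory.
Import numFieldNormedType.Exports.
Local Open Scope classical_set_scope.
Local Open Scope ring_scope.
Set Implicit Arguments.
Unset Strict Implicit.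

(** * Eigenvalues and the growth of matrix powers *)

Section SpectralRadius.
Variable R : realType.
Implicit Types (n : nat) (z : R[i]).
Local Notation normc := (@Normc.normc R).
Local Notation cplx M := (map_mx (fun x : R => (x%:C)%C) M).

Lemma normc_ge0 z : 0 <= normc z.
Proof. by case: z => a b; rewrite /Normc.normc sqrtr_ge0. Qed.

Lemma normc_real (x : R) : normc (x%:C)%C = `|x|.
Proof. by rewrite /Normc.normc /= expr0n addr0 sqrtr_sqr. Qed.

Lemma normcX z m : normc (z ^+ m) = normc z ^+ m.
Proof.
by elim: m => [|m IH]; rewrite ?expr0 ?Normc.normc1 // !exprS Normc.normcM IH.
Qed.

Lemma normc_sum (I : finType) (F : I -> R[i]) :
  normc (\sum_i F i) <= \sum_i normc (F i).
Proof.
elim/big_ind2 : _ => [|x1 x2 y1 y2 h1 h2|//]; first by rewrite Normc.normc0.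
by apply: le_trans (le_normcD _ _) _; rewrite lerD.
Qed.

(* Solving the first-order recurrence a_(m+1) = z a_m + b_m removes one root
   of the annihilating polynomial at a time. *)
Lemma horner_mx_growth n (M : 'M[R[i]]_n.+1) (mu : R) (s : seq R[i])
    (q : {poly R[i]}) i j :
  0 < mu -> (forall z, z \in s -> normc z < mu) ->
  horner_mx M (q * \prod_(z <- s) ('X - z%:P)) = 0 ->
  exists2 C, 0 <= C &
    forall m, normc (horner_mx M (q * 'X^m) i j) <= C * mu ^+ m.
Proof.
move=> mu0; elim: s q => [|z s IH] q hs.
  rewrite big_nil mulr1 => q0; exists 0 => // m.
  by rewrite rmorphM /= q0 mul0r mxE Normc.normc0 mul0r.
rewrite big_cons mulrA => /IH[|C C0 hC].
  by move=> y ys; apply: hs; rewrite in_cons ys orbT.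
have zmu : 0 < mu - normc z by rewrite subr_gt0 hs // in_cons eqxx.
pose D := normc (horner_mx M q i j) + C / (mu - normc z).
have D0 : 0 <= D by rewrite addr_ge0 ?normc_ge0 // divr_ge0 // ltW.
exists D => //; elim=> [|m IHm].
  by rewrite !expr0 !mulr1 /D lerDl divr_ge0 // ltW.
have -> : q * 'X^(m.+1) = q * ('X - z%:P) * 'X^m + z *: (q * 'X^m).
  by rewrite -mul_polyC exprS; ring.
rewrite raddfD /= linearZ /= !mxE.
apply: le_trans (le_normcD _ _) _; rewrite Normc.normcM.
apply: le_trans (lerD (hC m) (ler_wpM2l (normc_ge0 z) IHm)) _.
rewrite mulrA -mulrDl exprS mulrA; apply: ler_wpM2r.
  by rewrite exprn_ge0 // ltW.
rewrite -lerBrDr (mulrC (normc z)) -mulrBr mulrDl divfK ?gt_eqF //.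
by rewrite lerDr mulr_ge0 ?normc_ge0 // ltW.
Qed.

Lemma char_poly_roots n (M : 'M[R]_n) :
  {s : seq R[i] | char_poly (cplx M) = \prod_(z <- s) ('X - z%:P) &
     forall z, (z \in s) = eigenvalue (cplx M) z}.
Proof.
have [s hs] := closed_field_poly_normal (char_poly (cplx M)).
have /eqP lc := char_poly_monic (cplx M).
exists s; first by rewrite {1}hs lc scale1r.
by move=> z; rewrite eigenvalue_root_char hs lc scale1r root_prod_XsubC.
Qed.

Lemma seq_argmax (s : seq R[i]) : s != [::] ->
  exists2 z, z \in s & forall y, y \in s -> normc y <= normc z.
Proof.
elim: s => [//|x [|y s] IH] _.
  by exists x; rewrite ?inE // => y; rewrite inE => /eqP ->.
have [//|z zs hz] := IH.
have [xz|/ltW zx] := leP (normc x) (normc z).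
  exists z; first by rewrite in_cons zs orbT.
  by move=> t; rewrite in_cons => /orP[/eqP->//|/hz].
exists x; first by rewrite in_cons eqxx.
by move=> t; rewrite in_cons => /orP[/eqP->//|/hz /le_trans]; apply.
Qed.

(** The finite set of eigenvalue moduli attains its supremum. An empty matrix has no eigenvalue and
    radius 0 by the convention for [sup], so a witness is claimed only for positive radius. *)
Lemma spectral_radius_max n (M : 'M[R]_n) :
  [/\ 0 <= spectral_radius M,
      forall z, eigenvalue (cplx M) z -> normc z <= spectral_radius M &
      0 < spectral_radius M ->
        exists2 z, eigenvalue (cplx M) z & normc z = spectral_radius M].
Proof.
have [s _ hs] := char_poly_roots M.
rewrite /spectral_radius; set E := [set _ | _ in _].
have [s0|/seq_argmax[z zs hz]] := eqVneq s [::].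
  have -> : E = set0.
    by apply/seteqP; split=> // x [z /=]; rewrite -hs s0.
  by rewrite sup0 ltxx; split=> // z; rewrite -hs s0.
have Ez : E (normc z) by exists z => //=; rewrite -hs.
have ubE : ubound E (normc z) by move=> _ [y /= ey <-]; apply: hz; rewrite hs.
have -> : sup E = normc z.
  apply/eqP; rewrite eq_le; apply/andP; split.
    by apply: ge_sup => //; exists (normc z).
  by apply: ub_le_sup => //; exists (normc z).
split; first exact: normc_ge0.
  by move=> y ey; apply: hz; rewrite hs.
by move=> _; exists z => //; rewrite -hs.
Qed.

Lemma cplxX n (M : 'M[R]_n.+1) m : cplx (M ^+ m) = cplx M ^+ m.
Proof. exact: (rmorphXn (map_mx (real_complex R))). Qed.

(** By Cayley-Hamilton the product of ['X - z%:P] over the eigenvalues kills [M], and each [z] has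
    modulus below [mu]; [horner_mx_growth] with [q = 1] then bounds every entry. *)
Lemma mxX_growth n (M : 'M[R]_n) (mu : R) : spectral_radius M < mu ->
  exists2 C, 0 < C & forall m i j, `|(M ^+ m) i j| <= C * mu ^+ m.
Proof.
case: n M => [|n] M hmu; first by exists 1 =>// m [].
have [l0 hl _] := spectral_radius_max M.
have mu0 := le_lt_trans l0 hmu.
have [s ps hs] := char_poly_roots M.
have h i j : exists C, 0 <= C /\ forall m, `|(M ^+ m) i j| <= C * mu ^+ m.
  have [||C C0 hC] := horner_mx_growth (M := cplx M) (s := s) (q := 1) i j mu0.
  - by move=> z; rewrite hs => /hl /le_lt_trans; apply.
  - by rewrite mul1r -ps Cayley_Hamilton.
  exists C; split=> // m; have := hC m.
  by rewrite mul1r rmorphXn /= horner_mx_X -cplxX mxE normc_real.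
have [f hf] := choice (fun ij : 'I_n.+1 * 'I_n.+1 => h ij.1 ij.2).
have f0 ij : 0 <= f ij by have [] := hf ij.
(* Summing the entrywise constants makes the bound uniform in [i] and [j]; the added 1 makes it
   positive. *)
exists (1 + \sum_ij f ij); first by rewrite ltr_wpDr // sumr_ge0.
move=> m i j; have [_ /(_ m)/le_trans] := hf (i, j); apply.
rewrite ler_wpM2r ?exprn_ge0 // 1?ltW // (bigD1 (i, j)) //=.
have : 0 <= \sum_(ij | ij != (i, j)) f ij by apply: sumr_ge0.
by lra.
Qed.

(** All eigenvalues are 0, so the characteristic polynomial is a power of ['X], and it kills [M]. *)
Lemma mxX_nilpotent n (M : 'M[R]_n) : spectral_radius M = 0 ->
  exists d, forall m, M ^+ (d + m) = 0.
Proof.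
case: n M => [|n] M l0; first by exists 0%N => m; apply/matrixP => -[].
have [_ hl _] := spectral_radius_max M.
have [s ps hs] := char_poly_roots M.
exists (size s) => m; rewrite exprD.
suff -> : M ^+ size s = 0 by rewrite mul0r.
have : horner_mx (cplx M) (\prod_(z <- s) ('X - z%:P)) = 0.
  by rewrite -ps Cayley_Hamilton.
have -> : \prod_(z <- s) ('X - z%:P) = 'X^(size s) :> {poly R[i]}.
  rewrite (eq_big_seq (fun=> 'X)) ?big_const_seq ?count_predT ?iter_mulr_1 //.
  move=> z; rewrite hs => /hl; rewrite l0 => z0.
  have /Normc.eq0_normc -> : normc z = 0.
    by apply/eqP; rewrite eq_le z0 normc_ge0.
  by rewrite subr0.
rewrite rmorphXn /= horner_mx_X -cplxX => /matrixP h.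
by apply/matrixP => i j; have := h i j; rewrite !mxE => -[].
Qed.

(** Take l1 norms in [v M^m = z^m v], with [v] a left eigenvector for an eigenvalue of maximal
    modulus: each [normc (v ord0 i)] is at most the norm [V], which then cancels. *)
Lemma mxX_lower n (M : 'M[R]_n) : (forall i j, 0 <= M i j) ->
  0 < spectral_radius M ->
  forall m, spectral_radius M ^+ m <= \sum_i \sum_j (M ^+ m) i j.
Proof.
case: n M => [|n] M M0 l0.
  have [_ _ /(_ l0)[z]] := spectral_radius_max M.
  by case/eigenvalueP=> v _ /eqP[]; apply/rowP => -[].
have [_ _ /(_ l0)[z /eigenvalueP[v vM v0] <-]] := spectral_radius_max M.
have MX0 m i j : 0 <= (M ^+ m) i j.
  elim: m i j => [|m IH] i j; first by rewrite expr0 mxE ler0n.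
  by rewrite exprS mxE sumr_ge0 // => k _; rewrite mulr_ge0.
have vMX m : v *m cplx (M ^+ m) = z ^+ m *: v.
  elim: m => [|m IH]; first by rewrite cplxX !expr0 scale1r mulmx1.
  rewrite cplxX exprSr mulmxA -cplxX IH -scalemxAl vM scalerA.
  by rewrite -exprSr.
pose V := \sum_i normc (v ord0 i).
have V0 : 0 < V.
  rewrite lt0r sumr_ge0 ?andbT; last by move=> i _; exact: normc_ge0.
  apply: contra v0 => /eqP V0; apply/eqP/rowP => i; rewrite mxE.
  apply: Normc.eq0_normc; move: V0; rewrite /V => /psumr_eq0P; apply=> //.
  by move=> k _; exact: normc_ge0.
move=> m; rewrite -normcX -(ler_pM2l V0).
have -> : V * normc (z ^+ m) = \sum_j normc ((z ^+ m *: v) ord0 j).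
  by rewrite mulr_suml; apply: eq_bigr => j _; rewrite mxE Normc.normcM mulrC.
rewrite -vMX exchange_big mulr_sumr; apply: ler_sum => j _.
rewrite mxE mulr_sumr; apply: le_trans (normc_sum _) _.
apply: ler_sum => i _; rewrite Normc.normcM mxE normc_real ger0_norm //.
rewrite ler_wpM2r // /V (bigD1 i) //= lerDl sumr_ge0 // => k _.
exact: normc_ge0.
Qed.

End SpectralRadius.

(** * From exponential bounds to a logarithmic rate *)

Lemma eln_gt0 (R : realType) (x : R) : 0 < x -> eln x = (ln x)%:E.
Proof. by move=> x0; rewrite /eln gt_eqF. Qed.

(** After taking logarithms and dividing by [m], the constants vanish in the limit. The upper bound
    is asked only for rates above [l], since Jordan blocks can add polynomial factors. *)
Lemma cvg_exponential_rate (R : realType) (a : nat -> R) (c l : R) :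
  0 < c -> 0 < l ->
  (\forall m \near \oo, c * l ^+ m <= a m) ->
  (forall mu, l < mu ->
     exists2 C, 0 < C & \forall m \near \oo, a m <= C * mu ^+ m) ->
  (fun m : nat => (- eln (a m) * ((m%:R : R)^-1)%:E)%E) @ \oo
    --> (- eln l)%E.
Proof.
move=> c0 l0 hlow hup.
have apos : \forall m \near \oo, 0 < a m.
  by apply: filterS hlow => m; apply: lt_le_trans; rewrite mulr_gt0 ?exprn_gt0.
have inv0 (x : R) : x * (m%:R)^-1 @[m --> \oo] --> (0 : R).
  rewrite -(mulr0 x); apply: cvgMl_tmp.
  apply/gtr0_cvgV0; last exact: cvgr_idn.
  by near=> m; rewrite ltr0n; near: m; exists 1%N.
rewrite eln_gt0 //.
apply: (@cvg_trans _ ((- (ln (a m) * (m%:R)^-1))%:E @[m --> \oo])).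
  apply: near_eq_cvg; near=> m.
  rewrite eln_gt0 ?EFinN ?EFinM ?muleN ?mulNe //; near: m; exact: apos.
apply: cvg_EFin; first by near=> m.
apply: (@cvgN R R^o).
apply/cvgrPdist_le => e e0.
(* This rate has logarithm [ln l + e / 2], which leaves the other [e / 2] for [ln C / m]. *)
have [|C C0 hC] := hup (l * expR (e / 2)).
  by rewrite ltr_pMr // expR_gt1 divr_gt0.
have e2 : 0 < e / 2 by rewrite divr_gt0.
have := inv0 (ln c) => /cvgr0Pnorm_le/(_ e e0) hc.
have := inv0 (ln C) => /cvgr0Pnorm_le/(_ _ e2) hC'.
near=> m.
have m0 : 0 < m%:R^-1 :> R.
  by rewrite invr_gt0 ltr0n; near: m; exists 1%N.
have mE : m%:R * m%:R^-1 = 1 :> R by rewrite divff // -invr_eq0 gt_eqF.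
have am0 : 0 < a m by near: m.
have h1 : ln c + ln l * m%:R <= ln (a m).
  rewrite mulr_natr -lnXn // -lnM ?posrE ?exprn_gt0 //.
  by rewrite ler_ln ?posrE ?mulr_gt0 ?exprn_gt0 //; near: m.
have h2 : ln (a m) <= ln C + (ln l + e / 2) * m%:R.
  rewrite -[e / 2]expRK -lnM ?posrE ?expR_gt0 //.
  rewrite mulr_natr -lnXn ?mulr_gt0 ?expR_gt0 //.
  rewrite -lnM ?posrE ?exprn_gt0 ?mulr_gt0 ?expR_gt0 //.
  by rewrite ler_ln ?posrE ?mulr_gt0 ?exprn_gt0 ?mulr_gt0 ?expR_gt0 //; near: m.
have := ler_wpM2r (ltW m0) h1; rewrite mulrDl -mulrA mE mulr1 => k1.
have := ler_wpM2r (ltW m0) h2; rewrite mulrDl -mulrA mE mulr1 => k2.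
have : `|ln c / m%:R| <= e by near: m.
have : `|ln C / m%:R| <= e / 2 by near: m.
by rewrite !ler_norml; move=> /andP[? ?] /andP[? ?]; apply/andP; split; lra.
Unshelve. all: by end_near.
Qed.

(** * Positivity of the stationary vector *)

Section Stationary.
Variables (R : realType) (N : nat) (A P : 'M[R]_N) (p : 'rV[R]_N).
Hypothesis A01 : forall i j, A i j = 0 \/ A i j = 1.
Hypothesis Airr : forall i j, exists n, (0 < n)%N /\ 0 < (A ^+ n) i j.
Hypothesis P0 : forall i j, 0 <= P i j.
Hypothesis P1 : forall i, \sum_j P i j = 1.
Hypothesis PA : forall i j, 0 < P i j <-> A i j = 1.
Hypothesis pP : p *m P = p.
Hypothesis p1 : \sum_j p ord0 j = 1.

Lemma adjacency_eq0 i j : A i j <> 1 -> P i j = 0.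
Proof. by move/PA/negP; rewrite lt0r P0 andbT negbK => /eqP. Qed.

Lemma adjacency_power_gt0 n i j : 0 < (A ^+ n.+1) i j ->
  exists2 k, A i k = 1 & 0 < (A ^+ n) k j.
Proof.
rewrite exprS mxE => h; apply: contrapT => hn; move: h.
rewrite ltNge => /negP; apply; apply: sumr_le0 => k _.
have [->|Aik] := A01 i k; first by rewrite mul0r.
rewrite Aik mul1r leNgt; apply/negP => hk; apply: hn.
by exists k.
Qed.

(* [|p|] is subinvariant with the same mass as [|p| P], hence invariant; the
   invariant vector [p + |p|] is nonnegative and irreducibility propagates its
   positivity. *)
Lemma stationary_gt0 i : 0 < p ord0 i.
Proof.
have pE j : \sum_k p ord0 k * P k j = p ord0 j.
  by rewrite -{2}pP mxE.
have absE j : \sum_k `|p ord0 k| * P k j = `|p ord0 j|.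
  have sub k : `|p ord0 k| <= \sum_m `|p ord0 m| * P m k.
    rewrite -{1}pE; apply: le_trans (ler_norm_sum _ _ _) _.
    by apply: ler_sum => m _; rewrite normrM (ger0_norm (P0 m k)).
  (* Unit row sums make the total defect 0, so every nonnegative defect is 0. *)
  have tot : \sum_k (\sum_m `|p ord0 m| * P m k - `|p ord0 k|) = 0.
    rewrite sumrB exchange_big /=.
    under eq_bigr do rewrite -mulr_sumr P1 mulr1.
    by rewrite subrr.
  apply/eqP; rewrite -subr_eq0; apply/eqP.
  move: tot => /psumr_eq0P; apply=> // k _.
  by rewrite subr_ge0.
pose q j := p ord0 j + `|p ord0 j|.
have qE j : \sum_k q k * P k j = q j.
  by rewrite /q; under eq_bigr do rewrite mulrDl; rewrite big_split /= pE absE.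
have q0 j : 0 <= q j by rewrite /q -lerBlDl sub0r -normrN ler_norm.
have qstep j k : A j k = 1 -> 0 < q j -> 0 < q k.
  move=> /PA Pjk qj; rewrite -qE (bigD1 j) //= ltr_wpDr ?mulr_gt0 //.
  by apply: sumr_ge0 => m _; rewrite mulr_ge0.
have qn n j k : 0 < (A ^+ n) j k -> 0 < q j -> 0 < q k.
  elim: n j => [|n IH] j.
    by rewrite expr0 mxE; case: eqP => [->|]; rewrite ?ltxx.
  by case/adjacency_power_gt0 => m Ajm /IH h /(qstep _ _ Ajm).
have [j qj] : exists j, 0 < q j.
  apply: contrapT => hn; have : \sum_j p ord0 j <= 0.
    apply: sumr_le0 => j _; rewrite leNgt; apply/negP => pj; apply: hn.
    by exists j; rewrite /q ltr_pwDl.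
  by rewrite p1 ler10.
(* If [p ord0 i <= 0], then [q i] is 0, although positivity of [q] spreads from [j] to [i]. *)
have [n [_ hn]] := Airr j i.
have := qn _ _ _ hn qj; rewrite /q ltNge; apply: contraTT.
by rewrite -leNgt => pi; rewrite (ler0_norm pi) subrr lexx.
Qed.

End Stationary.

(** * Splitting sums over words *)

Section TupleSums.
Variables (V : nmodType) (T : finType).

Lemma sum_tuple0 (F : seq T -> V) : \sum_(w : 0.-tuple T) F w = F [::].
Proof.
rewrite (big_pred1 [tuple]) // => w.
by apply/esym/eqP/val_inj; rewrite /= (size0nil (size_tuple w)).
Qed.

Lemma sum_tupleS n (F : seq T -> V) :
  \sum_(w : n.+1.-tuple T) F w = \sum_a \sum_(u : n.-tuple T) F (a :: u).
Proof.
rewrite pair_big /=.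
rewrite (reindex (fun x : T * n.-tuple T => [tuple of x.1 :: x.2])) //=.
exists (fun w : n.+1.-tuple T => (thead w, [tuple of behead w])) => /=.
  by case=> a u _; congr (_, _); apply/val_inj.
by move=> w _; apply/val_inj; rewrite [in RHS](tuple_eta w).
Qed.

Lemma sum_tupleD m n (F : seq T -> V) :
  \sum_(w : (m + n).-tuple T) F w =
  \sum_(u : m.-tuple T) \sum_(v : n.-tuple T) F (u ++ v).
Proof.
elim: m F => [|m IH] F.
  by rewrite (sum_tuple0 (fun u => \sum_(v : n.-tuple T) F (u ++ v))).
rewrite (sum_tupleS (m + n)).
rewrite (sum_tupleS _ (fun u => \sum_(v : n.-tuple T) F (u ++ v))).
by apply: eq_bigr => a _; rewrite (IH (fun w => F (a :: w))).
Qed.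

Lemma sum_tuple_rcons n (F : seq T -> V) :
  \sum_(w : n.+1.-tuple T) F w =
  \sum_(u : n.-tuple T) \sum_a F (rcons u a).
Proof.
rewrite -addn1 sum_tupleD; apply: eq_bigr => u _.
rewrite (sum_tupleS 0 (fun v => F (u ++ v))); apply: eq_bigr => a _.
by rewrite (sum_tuple0 (fun v => F (u ++ a :: v))) cats1.
Qed.

End TupleSums.

(** * Words containing no word of the hole *)

Section Words.
Variables (N : nat) (G : seq (word N)).

Definition clean (w : word N) := all (fun g => ~~ infix g w) G.

Lemma clean_infix v w : infix v w -> clean w -> clean v.
Proof.
move=> vw /allP h; apply/allP => g /h; apply: contra => gv.
exact: infix_trans gv vw.
Qed.

Lemma clean_catl v w : clean (v ++ w) -> clean v.
Proof. by apply: clean_infix; exact: prefix_infix. Qed.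

Lemma clean_catr v w : clean (v ++ w) -> clean w.
Proof. by apply: clean_infix; exact: suffix_infix. Qed.

(** An occurrence starting at the first letter of [X] ends within [rcons X y], by the length bound;
    any other one lies in what follows that letter. So one transition between blocks tests just one
    new window. *)
Lemma clean_cat_cons k X y u : (forall g, g \in G -> (size g <= k.+2)%N) ->
  size X = k.+1 ->
  clean (X ++ y :: u) = clean (rcons X y) && clean (rcons (behead X) y ++ u).
Proof.
move=> hG; case: X => [//|x t] /= [st].
rewrite /clean -all_predI; apply: eq_in_all => g /hG sg.
rewrite -[LHS]/(~~ infix g (x :: t ++ y :: u)).
rewrite -[RHS]/(~~ infix g (x :: rcons t y) && ~~ infix g (rcons t y ++ u)).
have -> : infix g (x :: t ++ y :: u) =
    prefix g (x :: rcons t y) || infix g (rcons t y ++ u).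
  rewrite infix_consl cat_rcons; congr (_ || _); rewrite -cat_rcons -cat_cons.
  by rewrite !prefixE takel_cat //= size_rcons st.
rewrite infix_consl; have := @infix_catr _ g (rcons t y) u.
case: (prefix _ _) => //=.
by case: (infix g (rcons t y)) => // ->.
Qed.

Lemma clean_avoids m w : clean w -> avoids G m w.
Proof.
move=> /allP h; apply/forallP => i; apply/allP => g /h.
apply: contra => /eqP <-.
apply: (@infix_trans _ (drop i w)); last exact: infix_drop.
exact: infix_take.
Qed.

(** An occurrence inside the first [m] letters starts at a position at most [m], and [avoids] tests
    all of these. *)
Lemma avoids_clean m w : avoids G m w -> clean (take m w).
Proof.
move=> /forallP h; apply/allP => g gG; apply/negP => /infixP[s [s' E]].
have sm : (size s < m.+1)%N.
  rewrite ltnS; apply: leq_trans (geq_minl m (size w)).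
  by rewrite -size_take_min E size_cat leq_addr.
have /allP/(_ g gG)/eqP := h (Ordinal sm); apply=> /=.
by rewrite -(cat_take_drop m w) E -!catA drop_size_cat // take_size_cat.
Qed.

End Words.

(** * Markov weights of paths and cylinders *)

Section Paths.
Variables (R : realType) (N : nat) (A P : 'M[R]_N) (p : 'rV[R]_N).
Hypothesis A01 : forall i j, A i j = 0 \/ A i j = 1.
Hypothesis Airr : forall i j, exists n, (0 < n)%N /\ 0 < (A ^+ n) i j.
Hypothesis P0 : forall i j, 0 <= P i j.
Hypothesis P1 : forall i, \sum_j P i j = 1.
Hypothesis PA : forall i j, 0 < P i j <-> A i j = 1.
Hypothesis p0 : forall i, 0 < p ord0 i.

(** The conditional probability of reading [u] right after the letter [a]; it separates the
    transitions from the initial law [p]. *)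
Fixpoint path_weight (a : 'I_N) (u : word N) : R :=
  if u is b :: u' then P a b * path_weight b u' else 1.

Local Notation adj := (fun a b : 'I_N => A a b == 1).

Lemma cyl_measure_cons a u :
  cyl_measure p P (a :: u) = p ord0 a * path_weight a u.
Proof.
rewrite /cyl_measure /=; congr (_ * _).
(* The default [c] of [nth] is separated from the head [b], which changes along the induction. *)
suff h c b : \prod_(i < size u) P (nth c (b :: u) i) (nth c u i) =
    path_weight b u.
  exact: h.
elim: u b => [|d u IH] b /=; first by rewrite big_ord0.
by rewrite big_ord_recl /=; congr (_ * _); exact: IH.
Qed.

Lemma path_weight_cat a u v :
  path_weight a (u ++ v) = path_weight a u * path_weight (last a u) v.
Proof. by elim: u a => [|b u IH] a /=; rewrite ?mul1r // IH mulrA. Qed.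

Lemma cyl_measure_cat x0 w u : w != [::] ->
  cyl_measure p P (w ++ u) = cyl_measure p P w * path_weight (last x0 w) u.
Proof.
case: w => [//|a w] _.
by rewrite cat_cons !cyl_measure_cons path_weight_cat mulrA.
Qed.

Lemma path_weight_ge0 a u : 0 <= path_weight a u.
Proof. by elim: u a => [|b u IH] a /=; rewrite ?ler01 ?mulr_ge0. Qed.

Lemma cyl_measure_ge0 w : 0 <= cyl_measure p P w.
Proof.
case: w => [|a u]; first exact: ler01.
by rewrite cyl_measure_cons mulr_ge0 ?path_weight_ge0 // ltW.
Qed.

Lemma sum_path_weight n a : \sum_(u : n.-tuple 'I_N) path_weight a u = 1.
Proof.
elim: n a => [|n IH] a; first by rewrite (sum_tuple0 (path_weight a)).
rewrite (sum_tupleS _ (path_weight a)) -(P1 a); apply: eq_bigr => b _ /=.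
by rewrite -mulr_sumr IH mulr1.
Qed.

Lemma path_weight_gt0 a u : (0 < path_weight a u) = path adj a u.
Proof.
elim: u a => [|b u IH] a /=; first by rewrite ltr01.
have [Aab|Aab] := eqVneq (A a b) 1.
  by rewrite pmulr_rgt0 ?IH //; exact/PA.
by rewrite (adjacency_eq0 P0 PA) ?mul0r ?ltxx //; exact/eqP.
Qed.

Lemma cyl_measure_gt0 w : (0 < cyl_measure p P w) = sorted adj w.
Proof.
case: w => [|a u]; first by rewrite ltr01.
by rewrite cyl_measure_cons pmulr_rgt0 // path_weight_gt0.
Qed.

Lemma cyl_measure_eq0 w : ~~ sorted adj w -> cyl_measure p P w = 0.
Proof.
by rewrite -cyl_measure_gt0 lt0r cyl_measure_ge0 andbT negbK => /eqP.
Qed.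

Lemma adjacency_successor a : exists b, A a b == 1.
Proof.
apply: contrapT => hn; have := P1 a.
rewrite big1 => [/esym/eqP|b _]; first by rewrite oner_eq0.
by apply: (adjacency_eq0 P0 PA) => /eqP Aab; apply: hn; exists b.
Qed.

(** Unit row sums give every letter a successor, so a finite admissible path extends to a point of
    the subshift. *)
Lemma allowed_sorted w : w != [::] -> allowed A w <-> sorted adj w.
Proof.
case: w => [//|a u] _; split.
  case=> x [xA [k ->]]; apply/(sortedP a) => i; rewrite size_mkseq => hi.
  by rewrite !nth_mkseq // ?addnS ?xA //; lia.
move=> hs; have [s hA] := choice adjacency_successor.
(* Past the word, the successor map [s] is iterated from the last letter; the first index outside,
   [(size u).+1], gets one application. *)
pose x i := if (i < size (a :: u))%N then nth a (a :: u) i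
            else iter (i - size u) s (last a u).
exists x; split; last first.
  exists 0%N; apply: (@eq_from_nth _ a); first by rewrite size_mkseq.
  by move=> i hi; rewrite nth_mkseq // add0n /x hi.
move=> i; rewrite /x; case: ltnP => h1; case: ltnP => h2.
- by apply/eqP; apply: (sortedP a hs).
- have -> : i = size u by move: h1 h2 => /=; lia.
  by rewrite subSnn /= -[size u]/(size (a :: u)).-1 nth_last; exact/eqP.
- by move: h1 h2 => /=; lia.
- rewrite subSn /=; [exact/eqP | exact: ltnW].
Qed.

Lemma adjacency_power_path n a b : 0 < (A ^+ n) a b ->
  exists u, [/\ path adj a u, last a u = b & size u = n].
Proof.
elim: n a => [|n IH] a.
  by rewrite expr0 mxE; case: eqP => [-> _|_]; [exists [::] | rewrite ltxx].
case/(adjacency_power_gt0 A01) => c Aac /IH[u [pu lu su]].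
by exists (c :: u); rewrite /= pu Aac eqxx su.
Qed.

(** * Survival probabilities and their decay *)

Variable G : seq (word N).

(** Allowedness is not tested: a word with a forbidden transition has measure 0. *)
Definition survival n : R :=
  \sum_(w : n.-tuple 'I_N | clean G w) cyl_measure p P w.

Lemma survivalE n :
  survival n = \sum_(w : n.-tuple 'I_N) (clean G w)%:R * cyl_measure p P w.
Proof.
rewrite /survival big_mkcond; apply: eq_bigr => w _.
by case: ifP; rewrite ?mul1r ?mul0r.
Qed.

Lemma survival_ge0 n : 0 <= survival n.
Proof. by apply: sumr_ge0 => w _; exact: cyl_measure_ge0. Qed.

Lemma mu_W_clean m : (0 < m + maxlen G)%N -> mu_W A p P G m =
  \sum_(w : (m + maxlen G).-tuple 'I_N) (avoids G m w)%:R * cyl_measure p P w.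
Proof.
move=> h; rewrite /mu_W big_mkcond; apply: eq_bigr => w _.
have w0 : tval w != [::] by rewrite -size_eq0 size_tuple -lt0n.
case: asboolP => [_|/(allowed_sorted w0)/negP/cyl_measure_eq0 ->] /=.
  by case: (avoids _ _ _); rewrite ?mul1r ?mul0r.
by rewrite mulr0.
Qed.

Lemma survival_le_mu_W m : (0 < m)%N ->
  survival (m + maxlen G) <= mu_W A p P G m.
Proof.
move=> m0; rewrite mu_W_clean ?addn_gt0 ?m0 // survivalE.
apply: ler_sum => w _; rewrite ler_wpM2r ?cyl_measure_ge0 // ler_nat.
by case h: (clean G w) => //; rewrite clean_avoids.
Qed.

(** The first [m] letters of a counted word are clean, and the cylinders of all extensions of a
    prefix add up to the cylinder of the prefix. *)
Lemma mu_W_le_survival m : (0 < m)%N -> mu_W A p P G m <= survival m.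
Proof.
case: m => // m _; rewrite mu_W_clean // survivalE.
rewrite (sum_tupleD _ _ (fun w => (avoids G m.+1 w)%:R * cyl_measure p P w)).
apply: ler_sum => u _.
pose x0 := thead u.
have u0 : tval u != [::] by rewrite -size_eq0 size_tuple.
have -> : cyl_measure p P u =
    \sum_(v : (maxlen G).-tuple 'I_N) cyl_measure p P (u ++ v).
  under eq_bigr do rewrite (cyl_measure_cat x0) //.
  by rewrite -mulr_sumr sum_path_weight mulr1.
rewrite mulr_sumr; apply: ler_sum => v _.
rewrite ler_wpM2r ?cyl_measure_ge0 // ler_nat.
case h: (avoids _ _ _) => //.
by have := avoids_clean h; rewrite take_size_cat ?size_tuple // => ->.
Qed.

(** The conditional probability, given the letter [a], that the next [n] letters are clean; [a]
    itself is not part of the tested word. *)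
Definition clean_mass n a : R :=
  \sum_(u : n.-tuple 'I_N) (clean G u)%:R * path_weight a u.

Lemma clean_massD m n a : clean_mass (m + n) a <= clean_mass m a.
Proof.
rewrite /clean_mass.
rewrite (sum_tupleD _ _ (fun w => (clean G w)%:R * path_weight a w)).
apply: ler_sum => u _.
rewrite -[leRHS]mulr1 -[X in _ <= _ * X](sum_path_weight n (last a u)).
rewrite mulr_sumr; apply: ler_sum => v _.
rewrite -mulrA -path_weight_cat ler_wpM2r ?path_weight_ge0 // ler_nat.
by case h: (clean G (u ++ v)) => //; rewrite (clean_catl h).
Qed.

(** Markov property: dropping the test for occurrences across the junction only increases the sum,
    and the continuation depends only on the last letter. *)
Lemma survivalD m n e : (0 < m)%N -> (forall a, clean_mass n a <= e) ->
  survival (m + n) <= survival m * e.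
Proof.
case: m => // m _ he; rewrite !survivalE.
rewrite (sum_tupleD _ _ (fun w => (clean G w)%:R * cyl_measure p P w)).
rewrite mulr_suml; apply: ler_sum => u _.
have u0 : tval u != [::] by rewrite -size_eq0 size_tuple.
apply: le_trans (ler_wpM2l _ (he (last (thead u) u))); last first.
  by rewrite mulr_ge0 ?ler0n ?cyl_measure_ge0.
rewrite mulr_sumr; apply: ler_sum => v _.
rewrite (cyl_measure_cat (thead u)) // mulrACA ler_wpM2r //.
  by rewrite mulr_ge0 ?path_weight_ge0 ?cyl_measure_ge0.
case h: (clean G (u ++ v)); last by rewrite mulr_ge0 ?ler0n.
by rewrite (clean_catl h) (clean_catr h) mulr1.
Qed.

Hypothesis G0 : G != [::].
Hypothesis GA : forall g, g \in G -> allowed A g /\ (0 < size g)%N.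

(** Irreducibility gives a path from [a] to the first letter of some [g] in [G]; prolonged along
    [g], it has positive weight and is lost from the total mass 1. *)
Lemma clean_mass_lt1 a : exists n, clean_mass n a < 1.
Proof.
have [g gG] : exists g, g \in G.
  by case: (G) G0 => // g G' _; exists g; rewrite mem_head.
have [gA] := GA gG; case: g gG gA => // b v gG gA _.
have {}gA : path adj b v by apply/(allowed_sorted (w := b :: v)).
have [n [n0 hn]] := Airr a b.
have [u [pu lu su]] := adjacency_power_path hn.
have puv : path adj a (u ++ v) by rewrite cat_path pu lu.
exists (size (u ++ v)); rewrite /clean_mass.
rewrite -[ltRHS](sum_path_weight (size (u ++ v)) a) -subr_gt0 -sumrB.
rewrite (bigD1 (in_tuple (u ++ v))) //=.
have -> : clean G (u ++ v) = false.
  apply/negbTE/allPn; exists (b :: v) => //; rewrite negbK; apply/infixP.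
  (* As [n] is positive, [u] is nonempty and ends in [b], so [b :: v] is a suffix of [u ++ v]. *)
  case/lastP: u {pu puv} lu su => [_ n0'|u c]; first by move: n0; rewrite -n0'.
  by rewrite last_rcons => -> _; exists u, [::]; rewrite cats0 cat_rcons.
rewrite mul0r subr0 ltr_pwDl ?path_weight_gt0 //.
apply: sumr_ge0 => w _; rewrite subr_ge0 -[leRHS]mul1r.
by rewrite ler_wpM2r ?path_weight_ge0 // lern1 leq_b1.
Qed.

(** Clean mass decreases with length, so one length beyond the finitely many chosen ones serves all
    letters; [e] is the largest mass there. *)
Lemma clean_mass_contracts : exists L e, [/\ (0 < L)%N, 0 <= e < 1 &
  forall a, clean_mass L a <= e].
Proof.
have [f hf] := choice clean_mass_lt1.
pose L := (\max_a f a).+1.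
have hL a : clean_mass L a < 1.
  apply: le_lt_trans (hf a).
  by rewrite -(subnKC (leqW (leq_bigmax a)) : _ = L) clean_massD.
exists L, (\big[Num.max/0]_a clean_mass L a); split=> //.
- rewrite bigmax_ge_id; apply: bigmax_lt => //; exact: ltr01.
- by move=> a; apply: le_bigmax.
Qed.

(** Geometric decay along the lengths [1 + j * L]; the start at 1 meets the positivity condition of
    [survivalD]. *)
Lemma survival_small (c : R) m0 : 0 < c ->
  exists2 m, (m0 <= m)%N & survival m < c.
Proof.
move=> c0; have [L [e [L0 /andP[e0 e1] he]]] := clean_mass_contracts.
have decay j : survival (1 + j * L) <= survival 1 * e ^+ j.
  elim: j => [|j IH]; first by rewrite mulr1.
  rewrite mulSnr addnA exprSr mulrA.
  by apply: le_trans (survivalD _ he) _; rewrite // ler_wpM2r.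
have /cvgr0Pnorm_lt/(_ c c0)[M _ hM] :
    survival 1 * e ^+ j @[j --> \oo] --> (0 : R).
  rewrite -(mulr0 (survival 1)); apply: cvgMl_tmp.
  by apply: cvg_expr; rewrite ger0_norm.
exists (1 + maxn m0 M * L)%N.
  rewrite (leq_trans (leq_maxl m0 M)) //.
  by rewrite (leq_trans (leq_pmulr _ L0)) // leqnSn.
apply: le_lt_trans (decay _) (le_lt_trans (ler_norm _) _).
by apply: hM; rewrite /= leq_maxr.
Qed.

(* [M] is the transition matrix of the process of blocks of length [k.+1] that
   is killed as soon as a word of [G] is completed; [v] lists the blocks. *)
Variables (x0 : 'I_N) (n k : nat) (M : 'M[R]_n) (v : 'I_n -> word N).
Hypothesis G_size : forall g, g \in G -> (size g <= k.+2)%N.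
Hypothesis v_size : forall i, size (v i) = k.+1.
Hypothesis v_gt0 : forall i, 0 < cyl_measure p P (v i).
Hypothesis v_sum : forall F : word N -> R,
  \sum_(w : k.+1.-tuple 'I_N) cyl_measure p P w * F w =
  \sum_i cyl_measure p P (v i) * F (v i).
Hypothesis M_ge0 : forall i j, 0 <= M i j.
Hypothesis M_step : forall i (F : word N -> R),
  \sum_j M i j * F (v j) =
  \sum_y (clean G (rcons (v i) y))%:R * P (last x0 (v i)) y
           * F (rcons (behead (v i)) y).

(** * Survival through powers of the killed block matrix *)

Lemma block_extensions m i :
  \sum_(u : m.-tuple 'I_N)
     (clean G (v i ++ u))%:R * path_weight (last x0 (v i)) u =
  \sum_j (M ^+ m) i j * (clean G (v j))%:R.
Proof.
elim: m i => [|m IH] i.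
  rewrite (sum_tuple0 (fun u => (clean G (v i ++ u))%:R *
    path_weight (last x0 (v i)) u)) /= cats0 mulr1.
  rewrite expr0 (bigD1 i) //= mxE eqxx mul1r big1 ?addr0 // => j ji.
  by rewrite mxE eq_sym (negbTE ji) mul0r.
under [RHS]eq_bigr do rewrite exprS mxE mulr_suml.
rewrite exchange_big /=.
under [RHS]eq_bigr do
  (under eq_bigr do rewrite -mulrA; rewrite -mulr_sumr -IH).
rewrite (M_step i (fun w => \sum_(u : m.-tuple 'I_N)
  (clean G (w ++ u))%:R * path_weight (last x0 w) u)).
rewrite (sum_tupleS _ (fun u => (clean G (v i ++ u))%:R *
    path_weight (last x0 (v i)) u)).
apply: eq_bigr => y _; rewrite mulr_sumr; apply: eq_bigr => u _ /=.
rewrite (clean_cat_cons _ _ G_size (v_size i)) last_rcons.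
by rewrite -mulnb natrM !mulrA; congr (_ * _); rewrite mulrAC.
Qed.

Lemma survival_block m : survival (k.+1 + m) =
  \sum_i cyl_measure p P (v i) * \sum_j (M ^+ m) i j * (clean G (v j))%:R.
Proof.
rewrite survivalE.
rewrite (sum_tupleD _ _ (fun w => (clean G w)%:R * cyl_measure p P w)).
under [RHS]eq_bigr do rewrite -block_extensions.
rewrite -(v_sum (fun w => \sum_(u : m.-tuple 'I_N)
  (clean G (w ++ u))%:R * path_weight (last x0 w) u)).
apply: eq_bigr => w _; rewrite mulr_sumr; apply: eq_bigr => u _.
rewrite (cyl_measure_cat x0) -?size_eq0 ?size_tuple //.
by rewrite mulrCA.
Qed.

(** The target block is a suffix of the window tested by the transition, so the nonnegative weights
    into unclean blocks sum to 0. *)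
Lemma block_matrix_clean i j : M i j * (clean G (v j))%:R = M i j.
Proof.
have : \sum_j M i j * (~~ clean G (v j))%:R = 0.
  rewrite (M_step i (fun w => (~~ clean G w)%:R)) big1 // => y _.
  case h: (clean G (rcons (v i) y)); last by rewrite !mul0r.
  suff -> : clean G (rcons (behead (v i)) y) by rewrite mulr0.
  have := v_size i; move: h; case: (v i) => //= a t h _.
  by apply: (clean_catr (v := [:: a])).
move=> /psumr_eq0P h.
have {}h : M i j * (~~ clean G (v j))%:R = 0.
  by apply: h => // q _; rewrite mulr_ge0.
by move: h; case: (clean G (v j)); rewrite ?mulr1 ?mulr0.
Qed.

Lemma block_mxX_ge0 m i j : 0 <= (M ^+ m) i j.
Proof.
elim: m i j => [|m IH] i j; first by rewrite expr0 mxE ler0n.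
by rewrite exprS mxE sumr_ge0 // => l _; rewrite mulr_ge0.
Qed.

Local Notation l := (spectral_radius M).

(** The constant is the least block measure, capped at 1. With exponent [m.+1] the last factor [M]
    absorbs the indicator of a clean final block. *)
Lemma survival_lower : 0 < l ->
  exists2 c, 0 < c & forall m, c * l ^+ m.+1 <= survival (k.+1 + m.+1).
Proof.
move=> l0.
pose c := \big[Num.min/1]_i cyl_measure p P (v i).
exists c; first by apply: lt_bigmin.
move=> m; rewrite survival_block.
apply: (@le_trans _ _ (c * \sum_i \sum_j (M ^+ m.+1) i j)).
  by rewrite ler_wpM2l ?mxX_lower //; apply: ltW; apply: lt_bigmin.
rewrite mulr_sumr; apply: ler_sum => i _.
have -> : \sum_j (M ^+ m.+1) i j * (clean G (v j))%:R = \sum_j (M ^+ m.+1) i j.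
  apply: eq_bigr => j _; rewrite exprSr mxE mulr_suml.
  by apply: eq_bigr => q _; rewrite -mulrA block_matrix_clean.
rewrite ler_wpM2r ?bigmin_le // sumr_ge0 // => j _; exact: block_mxX_ge0.
Qed.

Lemma survival_upper mu : l < mu ->
  exists2 C, 0 < C & forall m, survival (k.+1 + m) <= C * mu ^+ m.
Proof.
move=> lmu; have [C C0 hC] := mxX_growth lmu.
have [l0 _ _] := spectral_radius_max M.
pose D := \sum_(i < n) \sum_(j < n) cyl_measure p P (v i) * C.
(* The added 1 keeps the constant positive even if there are no blocks. *)
exists (1 + D).
  by rewrite ltr_wpDr // !sumr_ge0 // => i _; rewrite sumr_ge0 // => j _;
     rewrite mulr_ge0 ?cyl_measure_ge0 // ltW.
move=> m; apply: (@le_trans _ _ (D * mu ^+ m)); last first.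
  by rewrite mulrDl mul1r lerDr exprn_ge0 // ltW // (le_lt_trans l0).
rewrite survival_block mulr_suml; apply: ler_sum => i _.
rewrite mulr_suml mulr_sumr; apply: ler_sum => j _.
rewrite -[leRHS]mulrA ler_wpM2l ?cyl_measure_ge0 //.
apply: le_trans (hC m i j); rewrite ger0_norm ?block_mxX_ge0 //.
by rewrite ler_piMr ?block_mxX_ge0 // lern1 leq_b1.
Qed.

Lemma survival_nilpotent : l = 0 -> exists d, forall m, survival (d + m) = 0.
Proof.
move=> /mxX_nilpotent[d hd]; exists (k.+1 + d)%N => m.
rewrite -addnA survival_block big1 // => i _.
by rewrite big1 ?mulr0 // => j _; rewrite hd mxE mul0r.
Qed.

(** If [l >= 1], the lower bound keeps [survival] above [c] at all large lengths, against its
    decay. *)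
Lemma block_radius_lt1 : l < 1.
Proof.
have [l0 _ _] := spectral_radius_max M.
rewrite ltNge; apply/negP => l1.
have [c c0 hc] := survival_lower (lt_le_trans ltr01 l1).
have [m mk] := survival_small k.+2 c0; rewrite ltNge => /negP; apply.
have := hc (m - k.+2)%N; rewrite addnS -addSn subnKC //.
by apply: le_trans; apply: ler_peMr; [exact: ltW | exact: exprn_ege1].
Qed.

Lemma escape_rate_block :
  (fun m : nat => (- eln (mu_W A p P G m) * ((m%:R : R)^-1)%:E)%E)
      @ \oo --> (- eln l)%E
  /\ (0 < - eln l)%E.
Proof.
have [l_ge0 _ _] := spectral_radius_max M.
have [l0|l0] := eqVneq l 0.
  (* Here [eln 0] is [-oo]: the measures vanish from some [m] on, and the rate is [+oo]. *)
  rewrite /eln l0 eqxx /=; split; last by rewrite ltry.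
  have [d hd] := survival_nilpotent l0.
  apply: (@cvg_trans _ ((+oo%E : \bar R) @[m --> \oo])); last exact: cvg_cst.
  apply: near_eq_cvg; exists d.+1 => // m /= dm.
  have m0 : (0 < m)%N by exact: leq_ltn_trans dm.
  have -> : mu_W A p P G m = 0.
    apply/eqP; rewrite eq_le (le_trans (mu_W_le_survival m0)).
      by rewrite (le_trans (survival_ge0 _) (survival_le_mu_W m0)).
    by rewrite -(subnKC (ltnW dm)) hd.
  by rewrite eqxx /= gt0_mulye // lte_fin invr_gt0 ltr0n.
have {l0}l0 : 0 < l by rewrite lt0r l0.
split; last first.
  by rewrite eln_gt0 // oppe_gt0 lte_fin ln_lt0 // l0 block_radius_lt1.
have [c c0 hc] := survival_lower l0.
(* The powers of [l] compensate the shifts: [mu_W] at [m] is at least [survival (m + maxlen G)], and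
   survival at [k.+1 + j] is compared with [l ^+ j]. *)
apply: (cvg_exponential_rate (c := c * l ^+ maxlen G / l ^+ k.+1)) => //.
- by rewrite divr_gt0 ?mulr_gt0 ?exprn_gt0.
- exists k.+2 => // m /= km.
  have m0 : (0 < m)%N by exact: leq_ltn_trans km.
  apply: le_trans (survival_le_mu_W m0).
  have := hc (m - k.+2 + maxlen G)%N.
  have -> : (k.+1 + (m - k.+2 + maxlen G).+1 = m + maxlen G)%N by lia.
  apply: le_trans; rewrite le_eqVlt; apply/orP; left; apply/eqP.
  rewrite mulrAC -(mulrA c) -exprD -mulrA; congr (_ * _).
  have -> : (maxlen G + m = k.+1 + (m - k.+2 + maxlen G).+1)%N by lia.
  by rewrite exprD mulrAC divff ?mul1r // expf_neq0 // gt_eqF.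
- move=> mu lmu; have [C C0 hC] := survival_upper lmu.
  have mu0 : 0 < mu by exact: lt_trans lmu.
  exists (C / mu ^+ k.+1); first by rewrite divr_gt0 ?exprn_gt0.
  exists k.+1 => // m /= km.
  have m0 : (0 < m)%N by exact: leq_ltn_trans km.
  apply: le_trans (mu_W_le_survival m0) _.
  have := hC (m - k.+1)%N; rewrite subnKC // => /le_trans; apply.
  rewrite -mulrA -{2}(subnKC km) exprD mulKf //.
  by rewrite expf_neq0 // gt_eqF.
Qed.

End Paths.

(** * The matrices of the open system as killed block matrices *)

Lemma clean_pair N (G : seq (word N)) i j :
  (forall g, g \in G -> size g = 1%N) ->
  clean G [:: i; j] = ([:: i] \notin G) && ([:: j] \notin G).
Proof.
move=> G1; apply/allP/andP => [h|[iG jG] g gG].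
  by split; apply/negP => /h; rewrite infix1s !inE eqxx ?orbT.
have := G1 g gG; case: g gG => [//|c [|//]] cG _.
rewrite infix1s !inE negb_or; apply/andP; split.
  by apply: contraNneq iG => <-.
by apply: contraNneq jG => <-.
Qed.

Section BlockMatrix.
Variables (R : realType) (N : nat) (A P : 'M[R]_N) (G : seq (word N)).
Hypothesis P0 : forall i j, 0 <= P i j.
Hypothesis P1 : forall i, \sum_j P i j = 1.
Hypothesis PA : forall i j, 0 < P i j <-> A i j = 1.
Variable x0 : 'I_N.
Local Notation adj := (fun a b : 'I_N => A a b == 1).

Lemma asbool_allowed w : w != [::] -> `[< allowed A w >] = sorted adj w.
Proof. by move=> w0; apply/asboolP/idP => /(allowed_sorted P0 P1 PA w0). Qed.

Lemma sum_Lw k (F : word N -> R) :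
  \sum_(i < #|{: Lw A k}|) F (val (val (enum_val i))) =
  \sum_(w : k.+1.-tuple 'I_N | `[< allowed A w >]) F w.
Proof.
rewrite -(big_enum_val (fun X : Lw A k => F (val (val X)))) /=.
rewrite [RHS](reindex_omap (val : Lw A k -> _) insub) /=; last first.
  by move=> w wA; rewrite insubT.
by apply: eq_bigl => X; rewrite (valP X) valK eqxx.
Qed.

Lemma star_rcons k (X Y : k.+1.-tuple 'I_N) :
  star X Y = rcons X (last x0 Y).
Proof.
rewrite /star size_tuple /= -cats1; congr (_ ++ _).
case/tupleP: Y => a u /=; rewrite -[RHS]/[:: last x0 (a :: u)].
rewrite lastI -cats1 drop_size_cat ?last_cat //.
by rewrite size_belast size_tuple.
Qed.

(** The allowedness tests disappear: [X] is already allowed, and a forbidden final transition makes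
    the factor [P] vanish. *)
Lemma hadamard_hole k (X Y : Lw A k) :
  hadamard (Bhole A G k) (Pblock A P k) X Y =
  (overlap (val X) (val Y) && clean G (rcons (val X) (last x0 (val Y))))%:R
    * P (last x0 (val X)) (last x0 (val Y)).
Proof.
have lastE (Z : k.+1.-tuple 'I_N) : tnth Z ord_max = last x0 Z.
  by rewrite (tnth_nth x0) -nth_last size_tuple.
rewrite /hadamard /Bhole /Pblock !lastE star_rcons -/(clean G _).
case: overlap => /=; last by rewrite !mul0r.
rewrite asbool_allowed -?size_eq0 ?size_rcons //.
have := valP X; rewrite asbool_allowed -?size_eq0 ?size_tuple //.
case: X Y => [[[|a X] sX] hX] [Y hY] //= pX; rewrite rcons_path pX /=.
have [h|/eqP h] := eqVneq (A _ _) 1; first by case: clean.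
by rewrite (adjacency_eq0 P0 PA h) !mulr0.
Qed.

(** The words overlapping [X] are [behead X] followed by one letter [y]; if such a word is not
    allowed, its term is 0 on both sides. *)
Lemma sum_step k (X : Lw A k) (F : word N -> R) :
  \sum_(j < #|{: Lw A k}|)
    (overlap (val X) (val (enum_val j)) &&
     clean G (rcons (val X) (last x0 (val (enum_val j)))))%:R
    * P (last x0 (val X)) (last x0 (val (enum_val j)))
    * F (val (val (enum_val j))) =
  \sum_y (clean G (rcons (val X) y))%:R * P (last x0 (val X)) y
           * F (rcons (behead (val X)) y).
Proof.
pose h (w : word N) := (overlap (val X) w &&
  clean G (rcons (val X) (last x0 w)))%:R * P (last x0 (val X)) (last x0 w).
rewrite (sum_Lw k (fun w => h w * F w)) /=.
have sX := valP X; rewrite asbool_allowed -?size_eq0 ?size_tuple // in sX.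
have overlapE (u : k.-tuple 'I_N) y :
    overlap (val X) (rcons u y) = (behead (val X) == u).
  by rewrite /overlap size_rcons size_tuple /= -cats1 take_size_cat ?size_tuple.
rewrite big_mkcond /= (sum_tuple_rcons k (fun w =>
  if `[< allowed A w >] then h w * F w else 0)) /=.
rewrite (bigD1 [tuple of behead (val X)]) //=.
rewrite [X in _ + X]big1 ?addr0; last first.
  move=> u uX; apply: big1 => y _; case: ifP => // _; rewrite /h overlapE.
  have /negbTE -> : behead (val X) != u.
    by apply: contra uX => /eqP uX; apply/eqP/val_inj.
  by rewrite !mul0r.
apply: eq_bigr => y _.
rewrite asbool_allowed -?size_eq0 ?size_rcons // /h.
rewrite (overlapE [tuple of behead (val X)]) eqxx last_rcons /=.
case: ifPn => // /negP hs.
(* All transitions but the last are inherited from [X], so the one into [y] must be forbidden. *)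
suff -> : P (last x0 (val X)) y = 0 by rewrite mulr0 mul0r.
apply: (adjacency_eq0 P0 PA) => /eqP Ay; apply: hs.
move: sX Ay; rewrite -[sval X]/(val X).
case: (val X) => -[|a [|b t]] //= _ /andP[_ pt] Ay.
by rewrite rcons_path pt.
Qed.

End BlockMatrix.

(** * Escape rates for holes of one-letter words and of longer words *)

Theorem theorem3p1 (R : realType) (N : nat) (A P : 'M[R]_N) (p : 'rV[R]_N)
    (G : seq (word N)) :
  (* A is a 0-1 matrix *)
  (forall i j, A i j = 0 \/ A i j = 1) ->
  (* A is irreducible *)
  (forall i j, exists n, (0 < n)%N /\ 0 < (A ^+ n) i j) ->
  (* P is row-stochastic and compatible with A *)
  (forall i j, 0 <= P i j) ->
  (forall i, \sum_j P i j = 1) ->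
  (forall i j, 0 < P i j <-> A i j = 1) ->
  (* p is the stationary vector of P *)
  p *m P = p ->
  \sum_j p ord0 j = 1 ->
  (* G is a finite nonempty collection of (nonempty) allowed words *)
  G != [::] ->
  (forall g, g \in G -> allowed A g /\ (0 < size g)%N) ->
  (fun m : nat => (- eln (mu_W A p P G m) * ((m%:R : R)^-1)%:E)%E)
      @ \oo --> (- eln (lambda_hole A P G))%E
  /\ (0 < - eln (lambda_hole A P G))%E.
Proof.
move=> A01 Airr P0 P1 PA pP p1 G0 GA.
have p0 : forall i, 0 < p ord0 i by exact: stationary_gt0 pP p1.
(* An empty alphabet would make the entries of [p] sum to 0. *)
have [x0 _] : exists x0 : 'I_N, True.
  apply: contrapT => h; move: p1; rewrite big1 => [/esym/eqP|j _].
    by rewrite oner_eq0.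
  by case: h; exists j.
have G_size g : g \in G -> (size g <= maxlen G)%N.
  by move=> gG; rewrite /maxlen; apply: leq_bigmax_seq.
rewrite /lambda_hole; case E: (maxlen G) => [|[|k]].
- have [g gG] : exists g, g \in G.
    by case: (G) G0 => // g G' _; exists g; rewrite mem_head.
  by have [_] := GA g gG; have := G_size g gG; rewrite E leqn0 => /eqP ->.
(* For maximal length 1 the blocks are single letters, and the required bound [k.+2 = 2] holds with
   room to spare. *)
- apply: (escape_rate_block A01 Airr P0 P1 PA p0 G0 GA (x0 := x0) (k := 0)
    (v := fun i => [:: i])) => //.
  + by move=> g /G_size; rewrite E => /leqW.
  + by move=> i; rewrite cyl_measure_cons mulr1.
  + move=> F; rewrite (sum_tupleS 0 (fun w => cyl_measure p P w * F w)).
    apply: eq_bigr => a _.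
    by rewrite (sum_tuple0 (fun u => cyl_measure p P (a :: u) * F (a :: u))).
  + move=> i j; rewrite !mxE /hadamard !mxE.
    by case: ifP; rewrite ?mul1r ?mul0r.
  + move=> i F; apply: eq_bigr => y _; rewrite mxE /hadamard mxE /=.
    rewrite clean_pair; last first.
      move=> g gG; apply/eqP; rewrite eqn_leq -{1}E G_size //.
      by have [] := GA g gG.
    rewrite (asbool_allowed P0 P1 PA) //= andbT; congr (_ * _).
    have [Aiy|Aiy] := eqVneq (A i y) 1; last first.
      by rewrite (adjacency_eq0 P0 PA (i := i) (j := y)) ?mulr0 //; exact/eqP.
    by rewrite /=; case: (_ && _).
(* For maximal length [k.+2] the blocks are the allowed words of length [k.+1]; all others have
   measure 0. *)
- apply: (escape_rate_block A01 Airr P0 P1 PA p0 G0 GA (x0 := x0) (k := k)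
    (v := fun i => val (val (enum_val i : Lw A k)))) => //.
  + by move=> g /G_size; rewrite E.
  + by move=> i; rewrite size_tuple.
  + move=> i; rewrite (cyl_measure_gt0 P0 PA p0) -(asbool_allowed P0 P1 PA).
      exact: (valP (enum_val i)).
    by rewrite -size_eq0 size_tuple.
  + move=> F; rewrite (sum_Lw _ _ (fun w => cyl_measure p P w * F w)).
    rewrite [RHS]big_mkcond; apply: eq_bigr => w _.
    rewrite (asbool_allowed P0 P1 PA) -?size_eq0 ?size_tuple //.
    by case: ifPn => // /(cyl_measure_eq0 P0 PA p0) ->; rewrite mul0r.
  + move=> i j; rewrite mxE /hadamard /Bhole /Pblock.
    by do 2![case: ifP => _]; rewrite ?mul1r ?mulr0 ?mul0r.
  + move=> i F; under eq_bigr do rewrite mxE (hadamard_hole G P0 P1 PA x0).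
    exact: (sum_step G P0 P1 PA x0 (enum_val i) F).
Qed.
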